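(* Let $n\ge 2$ and $k$ be integers with $0<k<n$, let $b\in\mathbb{C}$, and let $$\varphi(z)=\frac{1}{2\pi i}\int_{C}\exp\left\{-wz+b\alpha w^{k+1}+\beta w^{n+1}\right\}\,dw,\qquad \alpha=\frac{(-1)^{k+1}}{k+1},\quad \beta=\frac{1}{n+1}.$$ If $z=|z|e^{i\theta}$, where $\theta$ satisfies $$-\frac{n\pi}{2n+2}<\theta<\frac{n\pi}{2n+2},$$ then there exist positive constants $K=K(\theta)$ and $M=M(\theta)$ that (for the given $n,k,b$) depend only on $\theta$, such that $$|\varphi(z)|\le M\exp\left\{-K|z|^{1+1/n}\right\}.$$
   Context: The contour $C$ runs from $\infty$ to $0$ along the ray $\arg w=-\pi/(n+1)$ and then from $0$ to $\infty$ along the ray $\arg w=\pi/(n+1)$. The parameters $n,k,b$ are fixed throughout; the constants $K,M$ are independent of $|z|$. *)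

(* Defs.v *)
From Stdlib Require Import Reals.
From Coquelicot Require Import Coquelicot.

Open Scope R_scope.

Definition Cexp (z : C) : C :=
  (exp (Re z) * cos (Im z), exp (Re z) * sin (Im z)).

Definition cis (t : R) : C := Cexp (Ci * RtoC t)%C.

(* Real power with base [x >= 0] and exponent [y > 0].  [Rpower] is not usable
   at base 0: since [ln 0 = 0], [Rpower 0 y = 1], whereas 0 to the [y] is 0. *)
Definition nonneg_power (x y : R) : R :=
  if Req_EM_T x 0 then 0 else Rpower x y.

(* Integral of [f] along the ray [arg w = a], parametrized by [w = t e^{ia}];
   the modulus [t] runs from the limit [Fa] to the limit [Fb], which fixes the
   orientation. *)
Definition ray_integral (f : C -> C) (a : R) (Fa Fb : (R -> Prop) -> Prop) : C :=
  RInt_gen (V := C_R_CompleteNormedModule)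
    (fun t : R => (f (RtoC t * cis a) * cis a)%C) Fa Fb.

(* Infinity to 0 along [arg w = - PI / (n+1)], then 0 to infinity along
   [arg w = PI / (n+1)]. *)
Definition contour_integral (n : nat) (f : C -> C) : C :=
  (ray_integral f (- PI / (INR n + 1)) (Rbar_locally p_infty) (at_point 0%R)
   + ray_integral f (PI / (INR n + 1)) (at_point 0%R) (Rbar_locally p_infty))%C.

Definition alpha (k : nat) : R := (-1) ^ (k + 1) / (INR k + 1).

Definition beta (n : nat) : R := 1 / (INR n + 1).

Definition phi (n k : nat) (b z : C) : C :=
  (/ (2 * RtoC PI * Ci)
   * contour_integral n
       (fun w : C =>
          Cexp (- w * z + b * RtoC (alpha k) * w ^ (k + 1)
                + RtoC (beta n) * w ^ (n + 1))))%C.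

(* Main.v *)
(* An entire [f] has the primitive [F w = int_0^1 f (t w) w dt], so the contour integral
   is [L1 - L2] with [L1], [L2] the limits of [F] at infinity along the upper and lower
   rays.  Inside the sector where [w ^ (n+1)] has negative real part the rays may be
   rotated, to angles [psi] and [- psi] with [psi] slightly above [PI / (2 (n+1))]; there
   both [- w z] and [beta w ^ (n+1)] have negative real part.  With [lam = |z| ^ (1/n)],
   the rays are started at modulus [s lam] for a small [s > 0] and joined by a chord, on
   which [- w z] dominates.  Everywhere on this path the real part of the exponent is at
   most [- K lam ^ (n+1)] up to a bounded term, since [w ^ (k+1)] is of lower order. *)

Require Import Defs.
From Stdlib Require Import Reals Lra Lia.
From Coquelicot Require Import Coquelicot.

(** * Componentwise differentiation and continuity of complex-valued functions *)

Local Notation R2 := (prod_UniformSpace R_UniformSpace R_UniformSpace).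

(** The two components are kept apart so that real calculus applies to each of them directly. *)
Definition cderiv (g : R -> C) (t : R) (l : C) : Prop :=
  is_derive (fun s => Re (g s)) t (Re l) /\
  is_derive (fun s => Im (g s)) t (Im l).

(** The domain is arbitrary because continuity is used both in one real variable and jointly in two,
    the latter for differentiation under the integral sign. *)
Definition ccont {T : UniformSpace} (g : T -> C) (x : T) : Prop :=
  continuous (fun s => Re (g s)) x /\ continuous (fun s => Im (g s)) x.

(* Holomorphy is tested along real curves, so that only real derivatives occur. *)
Definition entire (f : C -> C) : Prop :=
  exists f' : C -> C,
    (forall g t l, cderiv g t l ->
       cderiv (fun s => f (g s)) t (f' (g t) * l)%C) /\
    (forall (T : UniformSpace) (g : T -> C) x, ccont g x -> ccont (fun s => f (g s)) x) /\
    (forall (T : UniformSpace) (g : T -> C) x, ccont g x -> ccont (fun s => f' (g s)) x).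

Lemma C_ext (a b : C) : Re a = Re b -> Im a = Im b -> a = b.
Proof. destruct a, b; simpl; intros; subst; reflexivity. Qed.

Lemma cderiv_const (c : C) t : cderiv (fun _ => c) t 0%C.
Proof. split; apply is_derive_Reals; apply derivable_pt_lim_const. Qed.

Lemma cderiv_plus g h t a b :
  cderiv g t a -> cderiv h t b -> cderiv (fun s => g s + h s)%C t (a + b)%C.
Proof. intros [A B] [D E]; split; now apply @is_derive_plus. Qed.

Lemma cderiv_mult g h t a b :
  cderiv g t a -> cderiv h t b ->
  cderiv (fun s => g s * h s)%C t (a * h t + g t * b)%C.
Proof.
  intros [A B] [D E]; split.
  - evar_last.
    + apply @is_derive_minus; apply @is_derive_mult; eauto; intros; apply Rmult_comm.
    + unfold minus, plus, opp, mult, Re, Im; simpl; ring.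
  - evar_last.
    + apply @is_derive_plus; apply @is_derive_mult; eauto; intros; apply Rmult_comm.
    + unfold minus, plus, opp, mult, Re, Im; simpl; ring.
Qed.

Lemma cderiv_exp g t a :
  cderiv g t a -> cderiv (fun s => Cexp (g s)) t (Cexp (g t) * a)%C.
Proof.
  intros [A B]; split; simpl.
  - evar_last.
    + apply @is_derive_mult; [ | | intros; apply Rmult_comm].
      * apply (is_derive_comp exp _ t); [apply is_derive_exp | exact A].
      * apply (is_derive_comp cos _ t); [apply is_derive_cos | exact B].
    + unfold plus, mult, scal, Re, Im; simpl; unfold mult; simpl; ring.
  - evar_last.
    + apply @is_derive_mult; [ | | intros; apply Rmult_comm].
      * apply (is_derive_comp exp _ t); [apply is_derive_exp | exact A].
      * apply (is_derive_comp sin _ t); [apply is_derive_sin | exact B].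
    + unfold plus, mult, scal, Re, Im; simpl; unfold mult; simpl; ring.
Qed.

Lemma ccont_const {T : UniformSpace} (c : C) (x : T) : ccont (fun _ => c) x.
Proof. split; apply continuous_const. Qed.

Lemma ccont_plus {T : UniformSpace} (g h : T -> C) x :
  ccont g x -> ccont h x -> ccont (fun s => g s + h s)%C x.
Proof. intros [A B] [D E]; split; now apply @continuous_plus. Qed.

Lemma ccont_mult {T : UniformSpace} (g h : T -> C) x :
  ccont g x -> ccont h x -> ccont (fun s => g s * h s)%C x.
Proof.
  intros [A B] [D E]; split; simpl.
  - apply @continuous_minus; now apply @continuous_mult.
  - apply @continuous_plus; now apply @continuous_mult.
Qed.

Lemma ccont_exp {T : UniformSpace} (g : T -> C) x :
  ccont g x -> ccont (fun s => Cexp (g s)) x.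
Proof.
  intros [A B]; split; simpl; apply @continuous_mult.
  - apply @continuous_comp; [exact A | apply continuous_exp].
  - apply @continuous_comp; [exact B | apply continuous_cos].
  - apply @continuous_comp; [exact A | apply continuous_exp].
  - apply @continuous_comp; [exact B | apply continuous_sin].
Qed.

Lemma cderiv_ccont g t a : cderiv g t a -> ccont g t.
Proof. intros [A B]; split; apply @ex_derive_continuous; eexists; eauto. Qed.

(** * Closure properties of entire functions *)

Lemma entire_const c : entire (fun _ => c).
Proof.
  exists (fun _ => 0%C); split; [|split]; intros; try apply ccont_const.
  rewrite Cmult_0_l; apply (cderiv_const c).
Qed.

Lemma entire_ext f h : (forall w, f w = h w) -> entire f -> entire h.
Proof.
  intros E (f' & A & B & D). exists f'; split; [|split]; [| |assumption].
  - intros g t l Hg. destruct (A g t l Hg) as [A1 A2].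
    split; [eapply is_derive_ext; [|exact A1] | eapply is_derive_ext; [|exact A2]];
      intros; simpl; now rewrite E.
  - intros T g x Hg. destruct (B T g x Hg) as [B1 B2].
    split; [eapply continuous_ext; [|exact B1] | eapply continuous_ext; [|exact B2]];
      intros; simpl; now rewrite E.
Qed.

Lemma entire_id : entire (fun w => w).
Proof.
  exists (fun _ => 1%C); split; [|split]; intros.
  - now rewrite Cmult_1_l.
  - assumption.
  - apply ccont_const.
Qed.

Lemma entire_plus f h : entire f -> entire h -> entire (fun w => f w + h w)%C.
Proof.
  intros (f' & A & B & D) (h' & A' & B' & D').
  exists (fun w => f' w + h' w)%C; split; [|split]; intros.
  - rewrite Cmult_plus_distr_r. apply cderiv_plus; auto.
  - apply ccont_plus; auto.
  - apply ccont_plus; auto.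
Qed.

Lemma entire_mult f h : entire f -> entire h -> entire (fun w => f w * h w)%C.
Proof.
  intros (f' & A & B & D) (h' & A' & B' & D').
  exists (fun w => f' w * h w + f w * h' w)%C; split; [|split]; intros.
  - replace ((f' (g t) * h (g t) + f (g t) * h' (g t)) * l)%C
      with (f' (g t) * l * h (g t) + f (g t) * (h' (g t) * l))%C by ring.
    apply (cderiv_mult (fun s => f (g s)) (fun s => h (g s))); auto.
  - apply ccont_mult; auto.
  - apply ccont_plus; apply ccont_mult; auto.
Qed.

Lemma entire_pow m : entire (fun w => w ^ m)%C.
Proof.
  induction m as [|m IH].
  - apply (entire_const 1%C).
  - apply (entire_mult (fun w => w) (fun w => w ^ m)%C); [apply entire_id | exact IH].
Qed.

Lemma entire_exp f : entire f -> entire (fun w => Cexp (f w)).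
Proof.
  intros (f' & A & B & D).
  exists (fun w => Cexp (f w) * f' w)%C; split; [|split]; intros.
  - rewrite <- Cmult_assoc. apply cderiv_exp with (g := fun s => f (g s)); auto.
  - apply ccont_exp; auto.
  - apply ccont_mult; [apply ccont_exp|]; auto.
Qed.

(** * The primitive obtained by integrating over the segment from 0 *)

Definition ray_primitive (f : C -> C) (w : C) : C :=
  (RInt (fun t => Re (f (RtoC t * w) * w)%C) 0 1,
   RInt (fun t => Im (f (RtoC t * w) * w)%C) 0 1).

Lemma cderiv_RtoC t : cderiv RtoC t 1%C.
Proof. split; simpl; [apply @is_derive_id | apply @is_derive_const]. Qed.

Lemma ccont_RtoC {T : UniformSpace} (h : T -> R) x :
  continuous h x -> ccont (fun s => RtoC (h s)) x.
Proof. split; simpl; [assumption | apply continuous_const]. Qed.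

Lemma ccont_comp {T U : UniformSpace} (h : T -> U) (g : U -> C) x :
  continuous h x -> ccont g (h x) -> ccont (fun s => g (h s)) x.
Proof.
  intros H [A B]; split; [apply (continuous_comp h (fun s => Re (g s))) |
    apply (continuous_comp h (fun s => Im (g s)))]; auto.
Qed.

(** Differentiation under the integral sign produces the integral of [D x] over [[0, 1]]; since [w]
    is a primitive of [D x], the fundamental theorem evaluates it. *)
Lemma is_derive_RInt_total (h D : R -> R -> R) (w : R -> R) (x : R) :
  (forall s t, is_derive (fun s => h s t) s (D s t)) ->
  (forall t, continuity_2d_pt D x t) ->
  (forall s t, continuous (h s) t) ->
  (forall t, is_derive w t (D x t)) ->
  (forall t, continuous (D x) t) ->
  is_derive (fun s => RInt (h s) 0 1) x (w 1 - w 0).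
Proof.
  intros Hh HD Hc Hw HDc. evar_last.
  - apply (is_derive_RInt_param h 0 1 x).
    + apply filter_forall; intros s t _. eexists; apply Hh.
    + intros t _. apply (continuity_2d_pt_ext D); [|apply HD].
      intros s r; symmetry; apply is_derive_unique, Hh.
    + apply filter_forall; intros s.
      apply (ex_RInt_continuous (V := R_CompleteNormedModule)); intros t _; apply Hc.
  - rewrite (RInt_ext _ (D x)) by (intros t _; apply is_derive_unique, Hh).
    apply is_RInt_unique.
    apply (is_RInt_derive (V := R_CompleteNormedModule) w); intros t _; auto.
Qed.

(* The total derivative of [t |-> t * f (t * w)] is [f (t w) + t w f' (t w)]:
   the derivative under the integral sign integrates to the boundary term. *)
Lemma ray_primitive_derive f g g' :
  entire f -> (forall t, cderiv g t (g' t)) -> (forall t, ccont g' t) ->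
  forall t, cderiv (fun s => ray_primitive f (g s)) t (f (g t) * g' t)%C.
Proof.
  intros (f' & Hd & Hc & Hc') Hg Hg' u.
  assert (Cg : forall s, ccont g s) by (intro; eapply cderiv_ccont; eauto).
  (* The derivative in [u] of the integrand [f (t * g u) * g u]. *)
  set (D := fun u t : R =>
    (f' (RtoC t * g u) * (RtoC t * g' u) * g u + f (RtoC t * g u) * g' u)%C).
  assert (HD : forall u t, cderiv (fun s => f (RtoC t * g s) * g s)%C u (D u t)).
  { intros v t. unfold D.
    apply (cderiv_mult (fun s => f (RtoC t * g s)%C)); [|auto].
    apply (Hd (fun s => RtoC t * g s)%C).
    replace (RtoC t * g' v)%C with (0 * g v + RtoC t * g' v)%C by ring.
    apply (cderiv_mult (fun _ => RtoC t)); [apply cderiv_const | auto]. }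
  assert (CD : forall u t, ccont (T := R2)
                 (fun p => D (fst p) (snd p)) (u, t)).
  { intros v t.
    assert (P1 : ccont (T := R2)
                   (fun p => RtoC (snd p)) (v, t))
      by (apply (ccont_RtoC (T := R2)
                   (fun p => snd p)); apply @continuous_snd).
    assert (P2 : ccont (T := R2)
                   (fun p => g (fst p)) (v, t))
      by (apply (ccont_comp (T := R2)
                   (fun p => fst p) g); [apply @continuous_fst | apply Cg]).
    assert (P3 : ccont (T := R2)
                   (fun p => g' (fst p)) (v, t))
      by (apply (ccont_comp (T := R2)
                   (fun p => fst p) g'); [apply @continuous_fst | apply Hg']).
    unfold D. apply ccont_plus; apply ccont_mult;
      [apply ccont_mult; [|apply ccont_mult] | | |]; auto.
    - apply (Hc' _ (fun p : R2 =>
                      RtoC (snd p) * g (fst p))%C); apply ccont_mult; auto.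
    - apply (Hc _ (fun p : R2 =>
                      RtoC (snd p) * g (fst p))%C); apply ccont_mult; auto. }
  assert (Ct : forall t, ccont RtoC t)
    by (intro; apply (ccont_RtoC (fun s : R => s)); apply continuous_id).
  assert (CI : forall u t, ccont (fun t => f (RtoC t * g u) * g u)%C t).
  { intros v t. apply ccont_mult; [|apply ccont_const].
    apply (Hc _ (fun t => RtoC t * g v)%C). apply ccont_mult; [apply Ct | apply ccont_const]. }
  assert (CDt : forall t, ccont (fun t => D u t) t).
  { intros t. unfold D.
    assert (ccont (fun t => RtoC t * g u)%C t)
      by (apply ccont_mult; [apply Ct | apply ccont_const]).
    apply ccont_plus; apply ccont_mult; [apply ccont_mult; [|apply ccont_mult] | | |];
      try apply ccont_const; try apply Ct.
    - now apply (Hc' _ (fun t => RtoC t * g u)%C).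
    - now apply (Hc _ (fun t => RtoC t * g u)%C). }
  (* Holomorphy enters here: the same complex factor [f'] governs variation in [t] and in [u], so
     the derivative in [t] is again [D]. *)
  assert (HT : forall t, cderiv (fun t => RtoC t * (f (RtoC t * g u) * g' u))%C t (D u t)).
  { intros t.
    replace (D u t) with (1 * (f (RtoC t * g u) * g' u) + RtoC t *
       ((f' (RtoC t * g u) * (1 * g u + RtoC t * 0)) * g' u + f (RtoC t * g u) * 0))%C
      by (unfold D; ring).
    apply (cderiv_mult RtoC (fun t => f (RtoC t * g u) * g' u)%C); [apply cderiv_RtoC|].
    apply (cderiv_mult (fun t => f (RtoC t * g u))%C (fun _ => g' u)); [|apply cderiv_const].
    apply (Hd (fun t => RtoC t * g u)%C).
    apply (cderiv_mult RtoC (fun _ => g u)); [apply cderiv_RtoC | apply cderiv_const]. }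
  split; simpl; (evar_last; [eapply (is_derive_RInt_total _ (fun s t => _ (D s t)))|]).
  - intros s t; exact (proj1 (HD s t)).
  - intros t; apply continuity_2d_pt_filterlim. exact (proj1 (CD u t)).
  - intros s t; exact (proj1 (CI s t)).
  - intros t; exact (proj1 (HT t)).
  - intros t; exact (proj1 (CDt t)).
  - cbv beta. rewrite !Cmult_0_l, !Cmult_1_l; simpl; ring.
  - intros s t; exact (proj2 (HD s t)).
  - intros t; apply continuity_2d_pt_filterlim. exact (proj2 (CD u t)).
  - intros s t; exact (proj2 (CI s t)).
  - intros t; exact (proj2 (HT t)).
  - intros t; exact (proj2 (CDt t)).
  - cbv beta. rewrite !Cmult_0_l, !Cmult_1_l; simpl; ring.
Qed.

(** * Unit complex numbers, moduli and elementary inequalities *)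

Lemma cis_eq t : cis t = (cos t, sin t).
Proof.
  unfold cis, Cexp; simpl.
  replace (0 * t - 1 * 0) with 0 by ring.
  replace (0 * 0 + 1 * t) with t by ring.
  rewrite exp_0; f_equal; ring.
Qed.

Lemma cis_plus s t : (cis s * cis t)%C = cis (s + t).
Proof.
  rewrite !cis_eq, cos_plus, sin_plus. apply C_ext; simpl; ring.
Qed.

Lemma cis_pow t m : (cis t ^ m)%C = cis (INR m * t).
Proof.
  induction m as [|m IH].
  - simpl. rewrite cis_eq, Rmult_0_l, cos_0, sin_0; reflexivity.
  - rewrite S_INR. change (cis t ^ S m)%C with (cis t * cis t ^ m)%C.
    rewrite IH, cis_plus. f_equal; ring.
Qed.

Lemma Cmod_cis t : Cmod (cis t) = 1.
Proof.
  rewrite cis_eq; unfold Cmod; simpl.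
  replace (cos t * (cos t * 1) + sin t * (sin t * 1)) with (Rsqr (sin t) + Rsqr (cos t))
    by (unfold Rsqr; ring).
  rewrite sin2_cos2. apply sqrt_1.
Qed.

Lemma Cmod_Cexp w : Cmod (Cexp w) = exp (Re w).
Proof.
  replace (Cexp w) with (RtoC (exp (Re w)) * cis (Im w))%C
    by (rewrite cis_eq; apply C_ext; simpl; ring).
  rewrite Cmod_mult, Cmod_cis, Cmod_R, Rabs_pos_eq; [ring | apply Rlt_le, exp_pos].
Qed.

Lemma Re_le_Cmod w : Re w <= Cmod w.
Proof.
  eapply Rle_trans; [apply Rle_abs|].
  eapply Rle_trans; [apply Rmax_l|]. apply Rmax_Cmod.
Qed.

Lemma Cmod_le_abs w : Cmod w <= Rabs (Re w) + Rabs (Im w).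
Proof.
  replace w with (RtoC (Re w) + Ci * RtoC (Im w))%C at 1 by (apply C_ext; simpl; ring).
  eapply Rle_trans; [apply Cmod_triangle|].
  rewrite Cmod_mult, Cmod_Ci, !Cmod_R; lra.
Qed.

Lemma cderiv_cis s t : cderiv (fun x => cis (s * x)) t (RtoC s * Ci * cis (s * t))%C.
Proof.
  replace (RtoC s * Ci * cis (s * t))%C
    with (cis (s * t) * (Ci * (0 * RtoC t + RtoC s * 1) + 0 * RtoC (s * t)))%C
    by (rewrite cis_eq; apply C_ext; simpl; ring).
  unfold cis at 1. apply cderiv_exp.
  split; simpl; auto_derive; auto; ring.
Qed.

(** The mean value theorem fails for complex values, so [g] is projected on the direction of
    [g b - g a] and the real theorem is applied to the projection. *)
Lemma mean_value_majorant (g g' : R -> C) (H h : R -> R) a b :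
  a <= b ->
  (forall t, cderiv g t (g' t)) -> (forall t, is_derive H t (h t)) ->
  (forall t, a <= t <= b -> Cmod (g' t) <= h t) ->
  Cmod (g b - g a) <= H b - H a.
Proof.
  intros Hab Hg HH Hle.
  set (d := (g b - g a)%C).
  (* Mean value theorem for [e * H] minus the projection of [g] on [(u, v)]; the disjunction
     postpones the derivative bound until [u], [v], [e] are chosen. *)
  assert (Hinc : forall u v e : R, 
    0 <= e * (H b - H a) - (u * Re d + v * Im d) \/ ~ (forall t, a <= t <= b ->
       u * Re (g' t) + v * Im (g' t) <= e * h t)).
  { intros u v e.
    destruct (MVT_gen (fun t => e * H t - (u * Re (g t) + v * Im (g t))) a b
      (fun t => e * h t - (u * Re (g' t) + v * Im (g' t)))) as (c & Hc & E).
    - intros t _. apply (is_derive_minus (V := R_NormedModule)).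
      + apply (is_derive_scal H); auto.
      + apply (is_derive_plus (V := R_NormedModule));
          apply (is_derive_scal _ t); apply (Hg t).
    - intros t _. apply derivable_continuous_pt.
      exists (e * h t - (u * Re (g' t) + v * Im (g' t))).
      apply is_derive_Reals. apply (is_derive_minus (V := R_NormedModule)).
      + apply (is_derive_scal H); auto.
      + apply (is_derive_plus (V := R_NormedModule));
          apply (is_derive_scal _ t); apply (Hg t).
    - rewrite Rmin_left, Rmax_right in Hc by lra.
      destruct (Rle_dec (u * Re (g' c) + v * Im (g' c)) (e * h c)) as [Q|Q].
      + left. unfold d. simpl in *.
        assert (0 <= (e * h c - (u * fst (g' c) + v * snd (g' c))) * (b - a))
          by (unfold Re, Im in Q; apply Rmult_le_pos; lra).
        unfold Re, Im in *; lra.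
      + right; intros A; apply Q, A, Hc. }
  assert (Hd : Cmod d * Cmod d = Re d * Re d + Im d * Im d).
  { unfold Cmod. rewrite sqrt_sqrt; [unfold Re, Im; ring|].
    apply Rplus_le_le_0_compat; apply pow2_ge_0. }
  destruct (Rle_lt_or_eq_dec 0 (Cmod d) (Cmod_ge_0 d)) as [P|P].
  (* With [(u, v) = d] the projection grows by [Cmod d] squared, and one factor [Cmod d] cancels.
     The derivative bound is the Cauchy-Schwarz inequality, read off from [Cconj d * g' t]. *)
  - destruct (Hinc (Re d) (Im d) (Cmod d)) as [Q|Q].
    + apply (Rmult_le_reg_l (Cmod d)); [assumption | lra].
    + exfalso; apply Q; intros t Ht.
      apply Rle_trans with (Cmod (Cconj d * g' t)).
      * eapply Rle_trans; [|apply Re_le_Cmod]. unfold Re, Im; simpl; lra.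
      * rewrite Cmod_mult, Cmod_conj. apply Rmult_le_compat_l; [lra | auto].
  (* When [d = 0] nothing can be cancelled; only the monotonicity of [H] is left to show. *)
  - rewrite <- P. destruct (Hinc 0 0 1) as [Q|Q]; [lra|].
    exfalso; apply Q; intros t Ht.
    generalize (Hle t Ht) (Cmod_ge_0 (g' t)); lra.
Qed.

Lemma exp_le_mono x y : x <= y -> exp x <= exp y.
Proof.
  intros [H|H]; [apply Rlt_le, exp_increasing, H | subst; apply Rle_refl].
Qed.

(** Beyond the threshold [q = max (1, A / c)] one extra factor [r] outweighs [A / c]; below it the
    left side is at most the constant [A * q ^ j]. *)
Lemma pow_le_higher (c A : R) (j m : nat) :
  0 < c -> 0 <= A -> (j < m)%nat ->
  exists D, forall r, 0 <= r -> A * r ^ j <= c * r ^ m + D.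
Proof.
  intros Hc HA Hjm. set (q := Rmax 1 (A / c)).
  assert (Hq : 1 <= q) by apply Rmax_l.
  assert (HAq : A <= c * q).
  { replace A with (c * (A / c)) by (field; lra).
    apply Rmult_le_compat_l; [lra | apply Rmax_r]. }
  exists (A * q ^ j).
  assert (0 <= q ^ j) by (apply pow_le; lra).
  intros r Hr.
  assert (0 <= c * r ^ m) by (apply Rmult_le_pos; [lra | apply pow_le; lra]).
  assert (0 <= A * q ^ j) by (apply Rmult_le_pos; lra).
  destruct (Rle_dec r q) as [Q|Q].
  - assert (A * r ^ j <= A * q ^ j)
      by (apply Rmult_le_compat_l; [lra | apply pow_incr; lra]). lra.
  - assert (r ^ j * r <= r ^ m).
    { replace (r ^ j * r) with (r ^ (S j)) by (simpl; ring).
      apply Rle_pow; [lra | lia]. }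
    assert (A * r ^ j <= c * r ^ m).
    { apply Rle_trans with (c * r * r ^ j).
      - apply Rmult_le_compat_r; [apply pow_le; lra|].
        apply Rle_trans with (c * q); [lra|]. apply Rmult_le_compat_l; lra.
      - replace (c * r * r ^ j) with (c * (r ^ j * r)) by ring.
        apply Rmult_le_compat_l; lra. }
    lra.
Qed.

(** This absorbs lower-order terms of an exponent into the leading one; after exponentiation [D]
    becomes a constant factor [exp D]. *)
Lemma linear_plus_pow_le (c A B : R) (j m : nat) :
  0 < c -> 0 <= A -> 0 <= B -> (1 < m)%nat -> (j < m)%nat ->
  exists D, forall r, 0 <= r -> A * r + B * r ^ j <= c * r ^ m + D.
Proof.
  intros Hc HA HB H1 Hj.
  destruct (pow_le_higher (c / 2) A 1 m) as [D1 E1]; auto; [lra|].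
  destruct (pow_le_higher (c / 2) B j m) as [D2 E2]; auto; [lra|].
  exists (D1 + D2); intros r Hr.
  specialize (E1 r Hr); specialize (E2 r Hr). rewrite pow_1 in E1. lra.
Qed.

(** * Ray integrals as limits of the primitive *)

Lemma ray_primitive_0 f : ray_primitive f 0%C = 0%C.
Proof.
  apply C_ext; simpl; rewrite (RInt_ext _ (fun _ => 0));
    try (rewrite RInt_const; apply Rmult_0_r);
    intros x _; simpl; ring.
Qed.

Lemma ccont_cis (s : R) t : ccont (fun x => cis (s * x)) t.
Proof. eapply cderiv_ccont, cderiv_cis. Qed.

Lemma ray_primitive_along_ray f a t : entire f ->
  cderiv (fun r => ray_primitive f (RtoC r * cis a)%C) t (f (RtoC t * cis a) * cis a)%C.
Proof.
  intros Hf.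
  apply (ray_primitive_derive f (fun r => RtoC r * cis a)%C (fun _ => cis a)); auto.
  - intros s.
    pose proof (cderiv_mult _ _ s _ _ (cderiv_RtoC s) (cderiv_const (cis a) s)) as E.
    cbv beta in E. now replace (1 * cis a + RtoC s * 0)%C with (cis a) in E by ring.
  - intros; apply ccont_const.
Qed.

Lemma is_RInt_ray f a x y : entire f ->
  is_RInt (V := C_R_NormedModule) (fun t : R => (f (RtoC t * cis a) * cis a)%C) x y
    (ray_primitive f (RtoC y * cis a) - ray_primitive f (RtoC x * cis a))%C.
Proof.
  intros Hf.
  assert (Hc : forall t, ccont (fun t => f (RtoC t * cis a) * cis a)%C t).
  { intros t. destruct Hf as (f' & _ & B & _).
    apply ccont_mult; [|apply ccont_const]. apply (B _ (fun t => RtoC t * cis a)%C).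
    apply ccont_mult; [|apply ccont_const].
    apply (ccont_RtoC (fun s : R => s)); apply continuous_id. }
  apply (is_RInt_fct_extend_pair (U := R_NormedModule) (V := R_NormedModule)).
  - apply (is_RInt_derive (V := R_CompleteNormedModule)
      (fun t => Re (ray_primitive f (RtoC t * cis a)%C))); intros t _.
    + exact (proj1 (ray_primitive_along_ray f a t Hf)).
    + exact (proj1 (Hc t)).
  - apply (is_RInt_derive (V := R_CompleteNormedModule)
      (fun t => Im (ray_primitive f (RtoC t * cis a)%C))); intros t _.
    + exact (proj2 (ray_primitive_along_ray f a t Hf)).
    + exact (proj2 (Hc t)).
Qed.

(** The primitive vanishes at 0, so the integral over a finite piece of the ray is the value at its
    far end. *)
Lemma ray_integral_out f a (L : C) : entire f ->
  filterlim (fun t : R => ray_primitive f (RtoC t * cis a)%C)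
    (Rbar_locally p_infty) (locally (T := C_UniformSpace) L) ->
  ray_integral f a (at_point 0) (Rbar_locally p_infty) = L.
Proof.
  intros Hf HL. apply (is_RInt_gen_unique (V := C_R_CompleteNormedModule)).
  intros P HP. apply HL in HP.
  exists (fun x => x = 0) (fun t => P (ray_primitive f (RtoC t * cis a)%C)).
  - unfold at_point; reflexivity.
  - exact HP.
  - intros x y -> Hy. exists (ray_primitive f (RtoC y * cis a)%C); split; [|exact Hy].
    simpl. replace (ray_primitive f (RtoC y * cis a)%C)
      with (ray_primitive f (RtoC y * cis a) - ray_primitive f (RtoC 0 * cis a))%C at 1
      by (rewrite Cmult_0_l, ray_primitive_0; ring).
    now apply is_RInt_ray.
Qed.

Lemma ray_integral_in f a (L : C) : entire f ->
  filterlim (fun t : R => ray_primitive f (RtoC t * cis a)%C)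
    (Rbar_locally p_infty) (locally (T := C_UniformSpace) L) ->
  ray_integral f a (Rbar_locally p_infty) (at_point 0) = (- L)%C.
Proof.
  intros Hf HL. apply (is_RInt_gen_unique (V := C_R_CompleteNormedModule)).
  intros P HP.
  apply (filterlim_opp (V := C_R_NormedModule) L) in HP.
  apply HL in HP.
  exists (fun t => P (- ray_primitive f (RtoC t * cis a))%C) (fun x => x = 0).
  - exact HP.
  - unfold at_point; reflexivity.
  - intros x y Hx ->. exists (- ray_primitive f (RtoC x * cis a))%C; split; [|exact Hx].
    simpl. replace (- ray_primitive f (RtoC x * cis a))%C
      with (ray_primitive f (RtoC 0 * cis a) - ray_primitive f (RtoC x * cis a))%C at 1
      by (rewrite Cmult_0_l, ray_primitive_0; ring).
    now apply is_RInt_ray.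
Qed.

(** * Limits at infinity under exponential bounds *)

Lemma is_lim_exp_opp A : is_lim (fun t => A * exp (- t)) p_infty 0.
Proof.
  evar_last.
  - apply is_lim_scal_l.
    apply (is_lim_comp exp Ropp p_infty 0 m_infty).
    + apply is_lim_exp_m.
    + apply (is_lim_opp (fun t => t) p_infty p_infty), is_lim_id.
    + exists 0; discriminate.
  - simpl; f_equal; ring.
Qed.

Lemma eventually_exp_opp_lt A (eps : R) : 0 < eps ->
  Rbar_locally p_infty (fun t => A * exp (- t) < eps).
Proof.
  intros He. pose proof (is_lim_exp_opp A) as L.
  apply is_lim_spec in L. specialize (L (mkposreal eps He)).
  revert L; apply filter_imp; intros t Ht; simpl in Ht.
  apply Rabs_def2 in Ht; lra.
Qed.

(** All increments beyond [s] are bounded by a quantity tending to 0, which is the Cauchy criterion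
    in a complete space. *)
Lemma exp_decay_cauchy (g : R -> C) A :
  (forall s t, 0 <= s <= t -> Cmod (g t - g s) <= A * exp (- s)) ->
  exists L : C, filterlim g (Rbar_locally p_infty) (locally (T := C_UniformSpace) L).
Proof.
  intros Hg.
  apply (filterlim_locally_cauchy (U := C_R_CompleteNormedModule) (F := Rbar_locally p_infty)).
  intros eps.
  exists (fun t => 0 <= t /\ A * exp (- t) < eps); split.
  - apply filter_and; [exists 0; intros; lra | apply eventually_exp_opp_lt, cond_pos].
  - assert (W : forall u v, 0 <= u /\ A * exp (- u) < eps ->
                  0 <= v /\ A * exp (- v) < eps -> Cmod (g v - g u) < eps).
    { intros u v [Hu Eu] [Hv Ev]. destruct (Rle_dec u v).
      - eapply Rle_lt_trans; [apply Hg|]; lra.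
      - replace (g v - g u)%C with (- (g u - g v))%C by ring. rewrite Cmod_opp.
        eapply Rle_lt_trans; [apply Hg|]; lra. }
    intros u v Hu Hv. specialize (W u v Hu Hv).
    pose proof (Rmax_Cmod (g v - g u)%C) as Q.
    split; eapply Rle_lt_trans; [|exact W| |exact W]; eapply Rle_trans; [|exact Q| |exact Q].
    + apply Rmax_l.
    + apply Rmax_r.
Qed.

Lemma limit_bound (g : R -> C) (L p : C) B A :
  filterlim g (Rbar_locally p_infty) (locally (T := C_UniformSpace) L) ->
  Rbar_locally p_infty (fun t => Cmod (g t - p) <= B + A * exp (- t)) ->
  Cmod (L - p) <= B.
Proof.
  intros HL Hg. apply le_epsilon; intros eps He.
  (* Balls are componentwise: one third for each component of [g t - L], one for the exponential
     excess. *)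
  assert (H3 : 0 < eps / 3) by lra.
  assert (N : Rbar_locally p_infty (fun t => ball (M := C_UniformSpace) L (eps / 3) (g t))).
  { apply HL. now exists (mkposreal _ H3). }
  destruct (filter_ex (F := Rbar_locally p_infty) _
    (filter_and _ _ N (filter_and _ _ Hg (eventually_exp_opp_lt A _ H3))))
    as (t & [B1 B2] & E1 & E2).
  replace (L - p)%C with (- (g t - L) + (g t - p))%C by ring.
  eapply Rle_trans; [apply Cmod_triangle|]. rewrite Cmod_opp.
  pose proof (Cmod_le_abs (g t - L)%C) as Q.
  change (Rabs (Re (g t - L)%C) < eps / 3) in B1.
  change (Rabs (Im (g t - L)%C) < eps / 3) in B2.
  lra.
Qed.

(** * Increments of the primitive along rays, arcs and chords *)

Lemma exp_primitive A t : is_derive (fun t => - A * exp (- t)) t (A * exp (- t)).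
Proof. auto_derive; auto; ring. Qed.

(** The majorant integrates to [A * (exp (- s) - exp (- t))]; dropping the second term makes the
    bound uniform in [t]. *)
Lemma ray_difference_bound f a A s t : entire f -> 0 <= A -> s <= t ->
  (forall r, s <= r -> Cmod (f (RtoC r * cis a)%C) <= A * exp (- r)) ->
  Cmod (ray_primitive f (RtoC t * cis a)%C - ray_primitive f (RtoC s * cis a)%C)
    <= A * exp (- s).
Proof.
  intros Hf HA Hst Hb.
  eapply Rle_trans.
  - apply (mean_value_majorant (fun r => ray_primitive f (RtoC r * cis a)%C)
      (fun r => f (RtoC r * cis a) * cis a)%C
      (fun t => - A * exp (- t)) (fun t => A * exp (- t))); auto.
    + intros; now apply ray_primitive_along_ray.
    + apply exp_primitive.
    + intros r [Hr _]. rewrite Cmod_mult, Cmod_cis, Rmult_1_r; auto.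
  - pose proof (Rmult_le_pos A (exp (- t)) HA (Rlt_le _ _ (exp_pos _))); lra.
Qed.

(** The sign [sg] lets one argument serve the upper and the lower arc, with [x] increasing in both
    cases. *)
Lemma arc_difference_bound f sg x1 x2 r B : entire f -> 0 <= r -> Rabs sg = 1 -> x1 <= x2 ->
  (forall x, x1 <= x <= x2 -> Cmod (f (RtoC r * cis (sg * x))%C) <= B) ->
  Cmod (ray_primitive f (RtoC r * cis (sg * x2))%C
        - ray_primitive f (RtoC r * cis (sg * x1))%C) <= B * r * (x2 - x1).
Proof.
  intros Hf Hr Hs Hx Hb.
  replace (B * r * (x2 - x1)) with (B * r * x2 - B * r * x1) by ring.
  apply (mean_value_majorant (fun x => ray_primitive f (RtoC r * cis (sg * x))%C)
      (fun x => f (RtoC r * cis (sg * x)) * (RtoC r * (RtoC sg * Ci * cis (sg * x))))%C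
      (fun x => B * r * x) (fun _ => B * r)); auto.
  - apply (ray_primitive_derive f (fun x => RtoC r * cis (sg * x))%C
             (fun x => RtoC r * (RtoC sg * Ci * cis (sg * x)))%C); auto.
    + intros t.
      pose proof (cderiv_mult _ _ t _ _ (cderiv_const (RtoC r) t) (cderiv_cis sg t)) as E.
      cbv beta in E. now rewrite Cmult_0_l, Cplus_0_l in E.
    + intros t. apply ccont_mult; [apply ccont_const|].
      apply (ccont_mult (fun _ => RtoC sg * Ci)%C); [apply ccont_const|].
      apply ccont_cis.
  - intros t. auto_derive; auto; ring.
  - intros x Hxx. rewrite !Cmod_mult, Cmod_Ci, Cmod_cis, !Cmod_R, Hs, (Rabs_pos_eq r) by lra.
    rewrite !Rmult_1_r. apply Rmult_le_compat_r; auto.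
Qed.

(* The arc at infinity contributes nothing, so the ray of
   angle [sg * x2] may be replaced by the ray of angle [sg * x1]. *)
Lemma rotated_ray_limit f sg x1 x2 A Q rho :
  entire f -> Rabs sg = 1 -> x1 <= x2 -> 0 <= A -> 0 <= Q -> 0 <= rho ->
  (forall r x, 0 <= r -> x1 <= x <= x2 ->
     Cmod (f (RtoC r * cis (sg * x))%C) <= Q * exp (- (2 * r))) ->
  (forall r, rho <= r -> Cmod (f (RtoC r * cis (sg * x1))%C) <= A * exp (- r)) ->
  exists L : C,
    filterlim (fun t : R => ray_primitive f (RtoC t * cis (sg * x2))%C)
      (Rbar_locally p_infty) (locally (T := C_UniformSpace) L) /\
    Cmod (L - ray_primitive f (RtoC rho * cis (sg * x1))%C) <= A.
Proof.
  intros Hf Hs Hx HA HQ Hrho HbQ HbA.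
  destruct (exp_decay_cauchy (fun t => ray_primitive f (RtoC t * cis (sg * x2))%C) Q)
    as [L HL].
  { intros s t Hst. apply ray_difference_bound; auto; try lra.
    intros r Hr. eapply Rle_trans; [apply HbQ; lra|].
    apply Rmult_le_compat_l; [lra | apply exp_le_mono; lra]. }
  exists L; split; [exact HL|].
  apply (limit_bound _ L _ A (Q * (x2 - x1)) HL).
  exists rho; intros t Ht.
  set (F := ray_primitive f).
  replace (F (RtoC t * cis (sg * x2)) - F (RtoC rho * cis (sg * x1)))%C
    with ((F (RtoC t * cis (sg * x1)) - F (RtoC rho * cis (sg * x1)))
          + (F (RtoC t * cis (sg * x2)) - F (RtoC t * cis (sg * x1))))%C
    by ring.
  unfold F. eapply Rle_trans; [apply Cmod_triangle|]. apply Rplus_le_compat.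
  - eapply Rle_trans; [apply (ray_difference_bound f (sg * x1) A); auto; lra|].
    rewrite <- (Rmult_1_r A) at 2. apply Rmult_le_compat_l; [lra|].
    rewrite <- exp_0; apply exp_le_mono; lra.
  - eapply Rle_trans.
    + apply (arc_difference_bound f sg x1 x2 t (Q * exp (- (2 * t)))); auto; [lra|].
      intros; apply HbQ; lra.
    + replace (Q * exp (- (2 * t)) * t * (x2 - x1))
        with (Q * (x2 - x1) * (exp (- (2 * t)) * t)) by ring.
      apply Rmult_le_compat_l; [apply Rmult_le_pos; lra|].
      (* The doubled decay rate leaves a spare [exp (- t)], which beats the factor [t] of the arc
         length. *)
      replace (- t) with (- (2 * t) + t) by ring. rewrite exp_plus.
      apply Rmult_le_compat_l; [apply Rlt_le, exp_pos|].
      pose proof (exp_ineq1_le t); lra.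
Qed.

Lemma chord_difference_bound f (p q : C) B : entire f ->
  (forall t, 0 <= t <= 1 -> Cmod (f (p + RtoC t * (q - p))%C) <= B) ->
  Cmod (ray_primitive f q - ray_primitive f p) <= B * Cmod (q - p).
Proof.
  intros Hf Hb.
  set (g := fun t : R => (p + RtoC t * (q - p))%C).
  replace q with (g 1) at 1 by (unfold g; ring).
  replace p with (g 0) at 1 by (unfold g; ring).
  replace (B * Cmod (q - p)) with (B * Cmod (q - p) * 1 - B * Cmod (q - p) * 0) by ring.
  apply (mean_value_majorant (fun t => ray_primitive f (g t)) (fun t => f (g t) * (q - p))%C
    (fun t => B * Cmod (q - p) * t) (fun _ => B * Cmod (q - p))); [lra| | |].
  - apply (ray_primitive_derive f g (fun _ => q - p)%C); auto.
    + intros t.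
      pose proof (cderiv_plus _ _ t _ _ (cderiv_const p t)
        (cderiv_mult _ _ t _ _ (cderiv_RtoC t) (cderiv_const (q - p)%C t))) as E.
      cbv beta in E.
      now replace (0 + (1 * (q - p) + RtoC t * 0))%C with (q - p)%C in E by ring.
    + intros; apply ccont_const.
  - intros t. auto_derive; auto; ring.
  - intros t Ht. rewrite Cmod_mult.
    apply Rmult_le_compat_r; [apply Cmod_ge_0 | now apply Hb].
Qed.

(** * Estimates of the integrand and of its primitive *)

Definition kernel (n k : nat) (b z w : C) : C :=
  Cexp (- w * z + b * RtoC (alpha k) * w ^ (k + 1) + RtoC (beta n) * w ^ (n + 1)).

Lemma entire_kernel n k b z : entire (kernel n k b z).
Proof.
  apply (entire_exp (fun w => - w * z + b * RtoC (alpha k) * w ^ (k + 1)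
                              + RtoC (beta n) * w ^ (n + 1))%C).
  apply entire_plus; [apply entire_plus|].
  - apply (entire_ext (fun w => w * - z)%C); [intros; ring|].
    apply (entire_mult (fun w => w)); [apply entire_id | apply entire_const].
  - apply (entire_mult (fun _ => _)); [apply entire_const | apply entire_pow].
  - apply (entire_mult (fun _ => _)); [apply entire_const | apply entire_pow].
Qed.

Lemma alpha_abs_le k : Rabs (alpha k) <= 1.
Proof.
  unfold alpha. pose proof (pos_INR k).
  rewrite Rabs_div, pow_1_abs, (Rabs_pos_eq (INR k + 1)) by lra.
  apply Rle_div_l; lra.
Qed.

Lemma beta_bounds n : 0 < beta n <= 1.
Proof.
  unfold beta. pose proof (pos_INR n). split.
  - apply Rdiv_lt_0_compat; lra.
  - apply Rle_div_l; lra.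
Qed.

Lemma Re_perturbation_le k (b w : C) :
  Re (b * RtoC (alpha k) * w ^ (k + 1)) <= Cmod b * Cmod w ^ (k + 1).
Proof.
  eapply Rle_trans; [apply Re_le_Cmod|]. rewrite !Cmod_mult, Cmod_R, Cmod_pow.
  apply Rmult_le_compat_r; [apply pow_le, Cmod_ge_0|].
  pose proof (alpha_abs_le k). pose proof (Cmod_ge_0 b).
  rewrite <- (Rmult_1_r (Cmod b)) at 2. now apply Rmult_le_compat_l.
Qed.

(** Taking the modulus of the top-degree term forgets its sign; this is affordable on the chord,
    where [w] is small compared with [lam]. *)
Lemma kernel_bound n k b z w :
  Cmod (kernel n k b z w) <=
    exp (- Re (w * z) + Cmod b * Cmod w ^ (k + 1) + Cmod w ^ (n + 1)).
Proof.
  unfold kernel. rewrite Cmod_Cexp, !re_plus. apply exp_le_mono.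
  replace (Re (- w * z)) with (- Re (w * z)) by (simpl; ring).
  pose proof (Re_perturbation_le k b w).
  pose proof (Re_le_Cmod (RtoC (beta n) * w ^ (n + 1))) as H1.
  destruct (beta_bounds n) as [B0 B1].
  rewrite Cmod_mult, Cmod_R, Cmod_pow, Rabs_pos_eq in H1 by lra.
  assert (beta n * Cmod w ^ (n + 1) <= 1 * Cmod w ^ (n + 1))
    by (apply Rmult_le_compat_r; [apply pow_le, Cmod_ge_0 | lra]).
  lra.
Qed.

(** On a ray the arguments are known, so the two main terms keep their cosines and only the
    perturbation is replaced by its modulus. *)
Lemma kernel_polar_bound n k b m theta r psi : 0 <= r ->
  Cmod (kernel n k b (RtoC m * cis theta) (RtoC r * cis psi)) <=
    exp (- (r * m * cos (psi + theta)) + Cmod b * r ^ (k + 1)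
         + beta n * cos (INR (n + 1) * psi) * r ^ (n + 1)).
Proof.
  intros Hr. unfold kernel. rewrite Cmod_Cexp, !re_plus. apply exp_le_mono.
  assert (Hm : Cmod (RtoC r * cis psi) = r)
    by (rewrite Cmod_mult, Cmod_cis, Cmod_R, Rabs_pos_eq; lra).
  pose proof (Re_perturbation_le k b (RtoC r * cis psi)) as H. rewrite Hm in H.
  replace (- (RtoC r * cis psi) * (RtoC m * cis theta))%C
    with (RtoC (- (r * m)) * (cis psi * cis theta))%C
    by (apply C_ext; simpl; ring).
  rewrite cis_plus, (cis_eq (psi + theta)).
  rewrite (Cpow_mult_l _ _ (n + 1)), (cis_pow _ (n + 1)), <- (RtoC_pow r (n + 1)),
    (cis_eq (INR _ * _)).
  rewrite !re_scal_l. unfold Re at 1 3; simpl fst. lra.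
Qed.

(* At angles [psi] and [- psi] the terms [- w z] and [beta w ^ (n+1)] decay separately as soon as
   [|theta| + psi < PI / 2] and [PI / 2 < (n+1) psi <= PI]; the hypothesis on
   [theta] says exactly that some [psi > PI / (2 (n+1))] satisfies both. *)
Lemma decay_angle n theta : (2 <= n)%nat ->
  - (INR n * PI / (2 * INR n + 2)) < theta < INR n * PI / (2 * INR n + 2) ->
  exists psi c d, psi <= PI / (INR n + 1) /\ 0 < c <= 1 /\ 0 < d /\
    (forall sg, Rabs sg = 1 -> c <= cos (sg * psi + theta)) /\
    (forall sg x, Rabs sg = 1 -> psi <= x <= PI / (INR n + 1) ->
       cos (INR (n + 1) * (sg * x)) <= - d).
Proof.
  intros Hn Ht.
  assert (HN : 2 <= INR n) by (apply (le_INR 2); exact Hn).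
  pose proof PI_RGT_0 as Hpi.
  set (P := PI / (INR n + 1)).
  assert (HP : 0 < P) by (apply Rdiv_lt_0_compat; lra).
  assert (HPn : (INR n + 1) * P = PI) by (unfold P; field; lra).
  replace (INR n * PI / (2 * INR n + 2)) with (PI / 2 - P / 2) in Ht
    by (unfold P; field; lra).
  (* The slack left by [theta], capped by [P] to keep [psi <= P]. Half of it raises [psi] above
     [P / 2], and the other half keeps [Rabs theta + psi] below [PI / 2]. *)
  set (e := Rmin (PI / 2 - P / 2 - Rabs theta) P).
  assert (Ha : Rabs theta < PI / 2 - P / 2) by (apply Rabs_def1; lra).
  assert (He0 : 0 < e) by (apply Rmin_glb_lt; lra).
  assert (He1 : e <= PI / 2 - P / 2 - Rabs theta) by apply Rmin_l.
  assert (He2 : e <= P) by apply Rmin_r.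
  set (psi := P / 2 + e / 2).
  assert (Hs : forall sg, Rabs sg = 1 -> sg = 1 \/ sg = -1).
  { intros sg; unfold Rabs; destruct (Rcase_abs sg); lra. }
  assert (Hth : - Rabs theta <= theta <= Rabs theta)
    by (unfold Rabs; destruct (Rcase_abs theta); lra).
  assert (Hcos : forall sg, Rabs sg = 1 -> 0 < cos (sg * psi + theta)).
  { intros sg Hsg. apply cos_gt_0; destruct (Hs sg Hsg) as [-> | ->]; unfold psi; lra. }
  assert (HNp : PI / 2 < (INR n + 1) * psi).
  { unfold psi. assert (0 < (INR n + 1) * e) by (apply Rmult_lt_0_compat; lra). lra. }
  assert (HNp' : (INR n + 1) * psi <= PI).
  { rewrite <- HPn. apply Rmult_le_compat_l; unfold psi; lra. }
  (* The smaller cosine serves both signs. Cosine decreases up to [PI], so [psi] itself is the worst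
     angle for the second bound. *)
  exists psi, (Rmin (cos (1 * psi + theta)) (cos (-1 * psi + theta))),
    (- cos ((INR n + 1) * psi)).
  split; [unfold psi; lra|]. split; [split|split; [|split]].
  - apply Rmin_glb_lt; apply Hcos; unfold Rabs; destruct (Rcase_abs _); lra.
  - eapply Rle_trans; [apply Rmin_l | apply COS_bound].
  - assert (cos ((INR n + 1) * psi) < 0) by (apply cos_lt_0; lra). lra.
  - intros sg Hsg. destruct (Hs sg Hsg) as [-> | ->]; [apply Rmin_l | apply Rmin_r].
  - intros sg x Hsg [Hx1 Hx2]. rewrite Ropp_involutive, plus_INR; simpl INR.
    assert (Hx : cos ((INR n + 1) * (sg * x)) = cos ((INR n + 1) * x)).
    { destruct (Hs sg Hsg) as [-> | ->].
      - f_equal; ring.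
      - rewrite <- cos_neg; f_equal; ring. }
    rewrite Hx.
    assert ((INR n + 1) * psi <= (INR n + 1) * x) by (apply Rmult_le_compat_l; lra).
    assert ((INR n + 1) * x <= PI) by (rewrite <- HPn; apply Rmult_le_compat_l; lra).
    apply cos_decr_1; lra.
Qed.

(** For [r >= s * lam] the term [- w z] alone gives the decay in [lam], while the top-degree term
    absorbs the perturbation up to a constant independent of [lam]. *)
Lemma kernel_ray_estimate n k b theta sg psi c d s :
  (2 <= n)%nat -> (k < n)%nat -> Rabs sg = 1 -> psi <= PI / (INR n + 1) ->
  0 < c -> 0 < d -> 0 <= s ->
  c <= cos (sg * psi + theta) ->
  (forall x, psi <= x <= PI / (INR n + 1) -> cos (INR (n + 1) * (sg * x)) <= - d) ->
  exists D, 0 < D /\ forall lam, 0 <= lam -> exists L : C,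
    filterlim (fun t : R => ray_primitive (kernel n k b (RtoC (lam ^ n) * cis theta))
                              (RtoC t * cis (sg * (PI / (INR n + 1))))%C)
      (Rbar_locally p_infty) (locally (T := C_UniformSpace) L) /\
    Cmod (L - ray_primitive (kernel n k b (RtoC (lam ^ n) * cis theta))
                (RtoC (s * lam) * cis (sg * psi))%C)
      <= D * exp (- (s * c) * lam ^ (n + 1)).
Proof.
  intros Hn Hk Hsg Hpsi Hc Hd Hs Hcos Hdec.
  destruct (beta_bounds n) as [Hb0 Hb1].
  assert (Hbd : 0 < beta n * d) by (apply Rmult_lt_0_compat; lra).
  assert (Hbeta : forall x r, 0 <= r -> psi <= x <= PI / (INR n + 1) ->
    beta n * cos (INR (n + 1) * (sg * x)) * r ^ (n + 1) <= - (beta n * d * r ^ (n + 1))).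
  { intros x r Hr Hx.
    replace (- (beta n * d * r ^ (n + 1))) with (beta n * (- d) * r ^ (n + 1)) by ring.
    apply Rmult_le_compat_r; [now apply pow_le|].
    apply Rmult_le_compat_l; [lra | auto]. }
  (* The linear term with coefficient 1 provides the factor [exp (- r)] required on the rotated
     ray. *)
  destruct (linear_plus_pow_le (beta n * d) 1 (Cmod b) (k + 1) (n + 1)) as [D1 HD1];
    [assumption | lra | apply Cmod_ge_0 | lia | lia |].
  exists (exp D1); split; [apply exp_pos|]. intros lam Hlam.
  assert (Hm : 0 <= lam ^ n) by now apply pow_le.
  (* Here [lam ^ n] covers the worst sign of [- w z] in the sector, and 2 provides
     [exp (- (2 * r))]. That [D2] depends on [lam] is harmless: it serves only for convergence and
     the vanishing arc. *)
  destruct (linear_plus_pow_le (beta n * d) (lam ^ n + 2) (Cmod b) (k + 1) (n + 1))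
    as [D2 HD2]; [assumption | lra | apply Cmod_ge_0 | lia | lia |].
  rewrite <- exp_plus.
  apply (rotated_ray_limit _ sg psi (PI / (INR n + 1)) _ (exp D2)); auto.
  - apply entire_kernel.
  - apply Rlt_le, exp_pos.
  - apply Rlt_le, exp_pos.
  - now apply Rmult_le_pos.
  - intros r x Hr Hx. eapply Rle_trans; [now apply kernel_polar_bound|].
    rewrite <- exp_plus. apply exp_le_mono.
    specialize (HD2 r Hr); specialize (Hbeta x r Hr Hx).
    assert (0 <= r * lam ^ n * (1 + cos (sg * x + theta))).
    { apply Rmult_le_pos; [now apply Rmult_le_pos|].
      pose proof (COS_bound (sg * x + theta)); lra. }
    lra.
  - intros r Hr.
    assert (Hr0 : 0 <= r) by (apply Rle_trans with (s * lam); [now apply Rmult_le_pos | auto]).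
    eapply Rle_trans; [now apply kernel_polar_bound|].
    rewrite <- exp_plus. apply exp_le_mono.
    specialize (HD1 r Hr0); specialize (Hbeta psi r Hr0 ltac:(lra)).
    assert (s * lam * lam ^ n * c <= r * lam ^ n * cos (sg * psi + theta)).
    { apply Rmult_le_compat; [|lra| |assumption].
      - repeat apply Rmult_le_pos; assumption.
      - now apply Rmult_le_compat_r. }
    replace (lam ^ (n + 1)) with (lam * lam ^ n) by (rewrite pow_add; ring).
    lra.
Qed.

(* On the chord [Re (w z)] is at least [s c lam ^ (n+1)], being affine; the choice
   [s = c / 2] keeps [|w| ^ (n+1) <= (s lam) ^ (n+1)] below half of that. *)
Lemma kernel_chord_estimate n k b theta psi c :
  (2 <= n)%nat -> (k < n)%nat -> 0 < c <= 1 ->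
  (forall sg, Rabs sg = 1 -> c <= cos (sg * psi + theta)) ->
  exists D, 0 < D /\ forall lam, 0 <= lam ->
    Cmod (ray_primitive (kernel n k b (RtoC (lam ^ n) * cis theta))
            (RtoC (c / 2 * lam) * cis (1 * psi))%C
          - ray_primitive (kernel n k b (RtoC (lam ^ n) * cis theta))
            (RtoC (c / 2 * lam) * cis (-1 * psi))%C)
      <= D * exp (- (c * c / 8) * lam ^ (n + 1)).
Proof.
  intros Hn Hk Hc Hcos.
  assert (Hcc : 0 < c * c / 8)
    by (unfold Rdiv; repeat apply Rmult_lt_0_compat; lra).
  (* Half of the rate [c * c / 4] is spent on the perturbation and on the factor [exp lam], which
     bounds the chord length. *)
  destruct (linear_plus_pow_le (c * c / 8) 1 (Cmod b) (k + 1) (n + 1)) as [D HD];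
    [assumption | lra | apply Cmod_ge_0 | lia | lia |].
  exists (exp D); split; [apply exp_pos|]. intros lam Hlam.
  set (rho := c / 2 * lam).
  assert (Hrho : 0 <= rho) by (apply Rmult_le_pos; lra).
  assert (Hrl : rho <= lam).
  { unfold rho. rewrite <- (Rmult_1_l lam) at 2. apply Rmult_le_compat_r; lra. }
  assert (Hm : 0 <= lam ^ n) by now apply pow_le.
  assert (HN : lam ^ (n + 1) = lam * lam ^ n) by (rewrite pow_add; ring).
  (* Since [c / 2 <= 1] and [n + 1 >= 2], the factor [(c / 2) ^ (n + 1)] is at most
     [(c / 2) ^ 2]. *)
  assert (Hrn : rho ^ (n + 1) <= c * c / 4 * lam ^ (n + 1)).
  { unfold rho. rewrite Rpow_mult_distr. apply Rmult_le_compat_r; [now apply pow_le|].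
    replace (c * c / 4) with ((c / 2) ^ 2) by field.
    replace (n + 1)%nat with (2 + (n - 1))%nat by lia. rewrite pow_add.
    rewrite <- (Rmult_1_r ((c / 2) ^ 2)) at 2.
    apply Rmult_le_compat_l; [apply pow2_ge_0|].
    rewrite <- (pow1 (n - 1)). apply pow_incr; lra. }
  assert (Hmod : forall a, Cmod (RtoC rho * cis a) = rho)
    by (intros; rewrite Cmod_mult, Cmod_cis, Cmod_R, Rabs_pos_eq; lra).
  set (p := (RtoC rho * cis (-1 * psi))%C). set (q := (RtoC rho * cis (1 * psi))%C).
  eapply Rle_trans.
  (* The rate is [c * c / 2] from [- w z], less [c * c / 4] for the top-degree term. *)
  - apply (chord_difference_bound _ p q
      (exp (- (c * c / 4) * lam ^ (n + 1) + Cmod b * lam ^ (k + 1)))).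
    + apply entire_kernel.
    + intros t Ht. eapply Rle_trans; [apply kernel_bound|]. apply exp_le_mono.
      assert (Hw : Cmod (p + RtoC t * (q - p)) <= rho).
      { replace (p + RtoC t * (q - p))%C with (RtoC (1 - t) * p + RtoC t * q)%C
          by (apply C_ext; simpl; ring).
        eapply Rle_trans; [apply Cmod_triangle|].
        rewrite (Cmod_mult _ p), (Cmod_mult _ q). unfold p, q.
        rewrite !Hmod, !Cmod_R, !Rabs_pos_eq by lra. lra. }
      assert (Hre : c * rho * lam ^ n
        <= Re ((p + RtoC t * (q - p)) * (RtoC (lam ^ n) * cis theta))).
      { replace ((p + RtoC t * (q - p)) * (RtoC (lam ^ n) * cis theta))%C
          with (RtoC (rho * lam ^ n) * (RtoC (1 - t) * cis (-1 * psi + theta)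
                 + RtoC t * cis (1 * psi + theta)))%C
          by (rewrite <- !cis_plus; unfold p, q; apply C_ext; simpl; ring).
        rewrite re_scal_l, re_plus, !re_scal_l, !cis_eq. simpl Re.
        replace (c * rho * lam ^ n) with (rho * lam ^ n * ((1 - t) * c + t * c)) by ring.
        apply Rmult_le_compat_l; [now apply Rmult_le_pos|].
        apply Rplus_le_compat; (apply Rmult_le_compat_l; [lra|]); apply Hcos;
          unfold Rabs; destruct (Rcase_abs _); lra. }
      assert (H1 : Cmod b * Cmod (p + RtoC t * (q - p)) ^ (k + 1) <= Cmod b * lam ^ (k + 1)).
      { apply Rmult_le_compat_l; [apply Cmod_ge_0|].
        apply pow_incr; split; [apply Cmod_ge_0 | lra]. }
      assert (H2 : Cmod (p + RtoC t * (q - p)) ^ (n + 1) <= c * c / 4 * lam ^ (n + 1)).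
      { eapply Rle_trans; [|exact Hrn]. apply pow_incr; split; [apply Cmod_ge_0 | lra]. }
      unfold rho in Hre. rewrite HN in *.
      lra.
  - apply Rle_trans with
      (exp (- (c * c / 4) * lam ^ (n + 1) + Cmod b * lam ^ (k + 1)) * exp lam).
    + apply Rmult_le_compat_l; [apply Rlt_le, exp_pos|].
      unfold Cminus. eapply Rle_trans; [apply Cmod_triangle|].
      rewrite Cmod_opp. unfold p, q. rewrite !Hmod.
      pose proof (exp_ineq1_le lam).
      assert (rho <= 1 / 2 * lam) by (unfold rho; apply Rmult_le_compat_r; lra). lra.
    + rewrite <- !exp_plus. apply exp_le_mono. specialize (HD lam Hlam). lra.
Qed.

(** * Passage to the n-th root of the modulus, and the final estimate *)

Lemma nth_root_exists n m : (2 <= n)%nat -> 0 <= m ->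
  exists lam, 0 <= lam /\ lam ^ n = m /\ nonneg_power m (1 + 1 / INR n) = lam ^ (n + 1).
Proof.
  intros Hn Hm. unfold nonneg_power.
  assert (HN : 2 <= INR n) by (apply (le_INR 2); exact Hn).
  (* [Rpower] is always positive, so the root of 0 is treated separately. *)
  destruct (Req_EM_T m 0) as [->|H0].
  - exists 0; split; [lra|]. split; [|symmetry]; apply pow_i; lia.
  - assert (E : Rpower m (1 / INR n) ^ n = m).
    { rewrite <- Rpower_pow, Rpower_mult by apply exp_pos.
      replace (1 / INR n * INR n) with 1 by (field; lra). apply Rpower_1; lra. }
    exists (Rpower m (1 / INR n)); split; [apply Rlt_le, exp_pos|]. split; [exact E|].
    rewrite pow_add, E, pow_1, Rpower_plus, Rpower_1 by lra. reflexivity.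
Qed.

Theorem theorem3 :
  forall (n k : nat) (b : C) (theta : R),
    (2 <= n)%nat -> (0 < k < n)%nat ->
    - (INR n * PI / (2 * INR n + 2)) < theta < INR n * PI / (2 * INR n + 2) ->
    exists K M : R, 0 < K /\ 0 < M /\
      forall z : C, z = (RtoC (Cmod z) * cis theta)%C ->
        Cmod (phi n k b z)
          <= M * exp (- K * nonneg_power (Cmod z) (1 + 1 / INR n)).
Proof.
  intros n k b theta Hn Hk Ht.
  destruct (decay_angle n theta Hn Ht) as (psi & c & d & Hpsi & Hc & Hd & Hcos & Hdec).
  assert (S1 : Rabs 1 = 1) by apply Rabs_R1.
  assert (S2 : Rabs (-1) = 1) by (rewrite Rabs_left; lra).
  (* The starting factor [c / 2] makes the rotated rays begin at the endpoints of the chord. *)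
  destruct (kernel_ray_estimate n k b theta 1 psi c d (c / 2)) as (D1 & P1 & E1);
    auto; try lia; try lra.
  destruct (kernel_ray_estimate n k b theta (-1) psi c d (c / 2)) as (D2 & P2 & E2);
    auto; try lia; try lra.
  destruct (kernel_chord_estimate n k b theta psi c) as (D3 & P3 & E3); auto; try lia.
  assert (Hcc : 0 < c * c) by (apply Rmult_lt_0_compat; lra).
  (* The rays decay at rate [c * c / 2] and the chord at [c * c / 8]; the smaller rate is kept and
     the constants add up. *)
  exists (c * c / 8), (D1 + D2 + D3). split; [lra|]. split; [lra|].
  intros z Hz.
  destruct (nth_root_exists n (Cmod z) Hn (Cmod_ge_0 z)) as (lam & Hlam & Hpow & ->).
  rewrite <- Hpow in Hz. rewrite Hz. clear z Hz Hpow.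
  destruct (E1 lam Hlam) as (L1 & F1 & B1). destruct (E2 lam Hlam) as (L2 & F2 & B2).
  specialize (E3 lam Hlam).
  set (z := (RtoC (lam ^ n) * cis theta)%C) in *.
  (* [L2] belongs to the lower ray, which is traversed inwards, hence the sign. *)
  assert (Hphi : phi n k b z = (/ (2 * RtoC PI * Ci) * (- L2 + L1))%C).
  { unfold phi, contour_integral. f_equal. f_equal.
    - apply (ray_integral_in (kernel n k b z)); [apply entire_kernel|].
      replace (- PI / (INR n + 1)) with (-1 * (PI / (INR n + 1)))
        by (unfold Rdiv; ring). exact F2.
    - apply (ray_integral_out (kernel n k b z)); [apply entire_kernel|].
      rewrite <- (Rmult_1_l (PI / (INR n + 1))). exact F1. }
  rewrite Hphi, Cmod_mult.
  assert (Hpre : 0 <= Cmod (/ (2 * RtoC PI * Ci)) <= 1).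
  { split; [apply Cmod_ge_0|].
    pose proof PI_RGT_0. pose proof PI2_3_2.
    assert (E : Cmod (2 * RtoC PI * Ci) = 2 * PI)
      by (rewrite !Cmod_mult, Cmod_Ci, !Cmod_R, !Rabs_pos_eq by lra; ring).
    rewrite Cmod_inv by (apply Cmod_gt_0; lra).
    rewrite E, <- Rinv_1. apply Rinv_le_contravar; lra. }
  apply Rle_trans with (1 * Cmod (- L2 + L1)).
  { apply Rmult_le_compat_r; [apply Cmod_ge_0 | lra]. }
  rewrite Rmult_1_l.
  set (F := ray_primitive (kernel n k b z)) in *.
  set (p := (RtoC (c / 2 * lam) * cis (1 * psi))%C) in *.
  set (q := (RtoC (c / 2 * lam) * cis (-1 * psi))%C) in *.
  (* The three summands are the upper rotated ray, the lower one traversed inwards, and the chord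
     from [q] to [p]. *)
  replace (- L2 + L1)%C with ((L1 - F p) + - (L2 - F q) + (F p - F q))%C by ring.
  eapply Rle_trans; [apply Cmod_triangle|].
  eapply Rle_trans; [apply Rplus_le_compat_r, Cmod_triangle|].
  rewrite Cmod_opp, !Rmult_plus_distr_r.
  assert (He : exp (- (c / 2 * c) * lam ^ (n + 1)) <= exp (- (c * c / 8) * lam ^ (n + 1))).
  { apply exp_le_mono. apply Rmult_le_compat_r; [now apply pow_le | lra]. }
  repeat apply Rplus_le_compat; [| |exact E3];
    (eapply Rle_trans; [eassumption|]); (apply Rmult_le_compat_l; [lra | exact He]).
Qed.
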